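(* Let $Q\subset\{0,\pm1\}^m$ be a set of vectors each having exactly $w$ nonzero coordinates, such that any two distinct vectors of $Q$ have inner product at most $s$. If $2w-m>s$, then $|Q|\le2^w$. In particular, the maximum size of a set of vectors in $\{0,\pm1\}^{11}$, each with exactly eight nonzero coordinates and with inner products of distinct vectors at most four, is $256$. *)

(* Defs.v *)
From mathcomp Require Import all_boot all_order all_algebra.
From mathcomp Require Import finmap.

Set Implicit Arguments.
Unset Strict Implicit.
Unset Printing Implicit Defensive.

Import Order.TTheory GRing.Theory Num.Theory.
Local Open Scope ring_scope.
Local Open Scope fset_scope.

Definition inner (m : nat) (x y : 'rV[int]_m) : int :=
  \sum_(i < m) x 0 i * y 0 i.

Definition ternary (m : nat) (x : 'rV[int]_m) : Prop :=
  forall i : 'I_m, x 0 i \in [:: 0; 1; -1].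

Definition weight (m : nat) (x : 'rV[int]_m) : nat :=
  #|[set i : 'I_m | x 0 i != 0]|.

(* A subset of {0, 1, -1}^m is finite, so finite sets of integer vectors lose
   no generality. *)
Definition ternary_code (m w : nat) (s : int) (Q : {fset 'rV[int]_m}) : Prop :=
  [/\ forall x, x \in Q -> ternary x,
      forall x, x \in Q -> weight x = w
    & forall x y, x \in Q -> y \in Q -> x != y -> inner x y <= s].

Definition max_code_size (m w : nat) (s : int) (N : nat) : Prop :=
  (exists2 Q : {fset 'rV[int]_m}, ternary_code w s Q & #|` Q| = N) /\
  (forall Q : {fset 'rV[int]_m}, ternary_code w s Q -> (#|` Q| <= N)%N).

(* Main.v *)
(* The sign vectors in {1, -1}^m that agree with a word of weight w on its
   support form a subcube of size 2^(m - w). If one sign vector agrees with both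
   x and y, then x and y agree on their common support, which has at least
   2w - m > s elements; so these subcubes are disjoint for distinct words, and
   |Q| 2^(m - w) <= 2^m. For (m, w, s) = (11, 8, 4) an explicit code turns them
   into a partition of the cube. *)
Require Import Defs.
From mathcomp Require Import all_boot all_order all_algebra.
From mathcomp Require Import finmap.

Set Implicit Arguments.
Unset Strict Implicit.
Unset Printing Implicit Defensive.

Import Order.TTheory GRing.Theory Num.Theory.
Local Open Scope ring_scope.
Local Open Scope fset_scope.

Lemma weightE m (x : 'rV[int]_m) :
  (weight x)%:Z = \sum_(i < m) (x 0 i != 0)%:Z.
Proof.
rewrite /weight -sum1_card big_mkcond /= -natz natr_sum.
by apply: eq_bigr => i _; rewrite inE; case: (x 0 i != 0).
Qed.

Lemma weight_leq m (x : 'rV[int]_m) : (weight x <= m)%N.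
Proof. by rewrite -[leqRHS]card_ord max_card. Qed.

Lemma inner_ternary m (x : 'rV[int]_m) :
  ternary x -> inner x x = (weight x)%:Z.
Proof.
move=> tx; rewrite weightE; apply: eq_bigr => i _.
by move: (tx i); rewrite !inE => /or3P[] /eqP->.
Qed.

(* Sign vectors, with [true] for -1, that agree with [x] on its support. *)
Definition subcube m (x : 'rV[int]_m) : {set {ffun 'I_m -> bool}} :=
  [set e in family (fun i => if x 0 i == 0 then predT
                             else pred1 (x 0 i == -1))].

Lemma card_subcube m (x : 'rV[int]_m) : #|subcube x| = (2 ^ (m - weight x))%N.
Proof.
rewrite cardsE card_family foldrE big_map big_enum /=.
rewrite (bigID (fun i => x 0 i == 0)) /= mulnC big1 ?mul1n; last first.
  by move=> i /negPf->; rewrite card1.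
rewrite (eq_bigr (fun=> 2)) => [|i ->]; last exact: card_bool.
rewrite prod_nat_const; congr (2 ^ _)%N.
rewrite -[X in (X - _)%N]card_ord -(cardsC [set i | x 0 i != 0]) addKn.
by apply: eq_card => i; rewrite !inE negbK.
Qed.

(** Termwise, [[x_i != 0] + [y_i != 0] - 1 <= x_i * y_i]: where both entries are nonzero, the common
    sign [e i] makes their product 1. *)
Lemma subcube_inner m (x y : 'rV[int]_m) e :
  ternary x -> ternary y -> e \in subcube x -> e \in subcube y ->
  (weight x)%:Z + (weight y)%:Z - m%:Z <= inner x y.
Proof.
rewrite !inE => tx ty /familyP ex /familyP ey.
have -> : m%:Z = \sum_(i < m) 1 by rewrite sumr_const card_ord natz.
rewrite !weightE -big_split -sumrB /=; apply: ler_sum => i _.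
move: (tx i) (ty i) (ex i) (ey i); rewrite !inE.
by move=> /or3P[] /eqP-> /or3P[] /eqP->; rewrite ?inE /=; case: (e i).
Qed.

Lemma ternary_code_bound m w (s : int) (Q : {fset 'rV[int]_m}) :
  ternary_code w s Q -> 2 * w%:Z - m%:Z > s -> (#|` Q| <= 2 ^ w)%N.
Proof.
case=> tQ wQ iQ s_lt.
(* A word in [Q] gives [w <= m], so [m - w] is not truncated. *)
have [->|[x0 x0Q]] := fset_0Vmem Q; first by rewrite cardfs0.
have le_wm : (w <= m)%N by rewrite -(wQ _ x0Q) weight_leq.
have disj (x y : Q) : x != y -> [disjoint subcube (val x) & subcube (val y)]%B.
  move=> neq_xy; apply/pred0P => e /=; apply/negP => /andP[ex ey].
  have := subcube_inner (tQ _ (valP x)) (tQ _ (valP y)) ex ey.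
  rewrite (wQ _ (valP x)) (wQ _ (valP y)) leNgt => /negP; apply.
  rewrite -mulr2n -mulr_natl; apply: le_lt_trans s_lt.
  exact: iQ (valP x) (valP y) neq_xy.
rewrite -(@leq_pmul2r (2 ^ (m - w))) ?expn_gt0 // -expnD subnKC //.
have -> : (#|` Q| * 2 ^ (m - w))%N = #|\bigcup_(x : Q) subcube (val x)|.
  rewrite -sum1_card partition_disjoint_bigcup //= cardfE -sum_nat_const.
  by apply: eq_bigr => x _; rewrite sum1_card card_subcube (wQ _ (valP x)).
by rewrite (leq_trans (max_card _)) // card_ffun card_bool card_ord.
Qed.

Fixpoint sign_seqs n : seq (seq int) :=
  if n is n'.+1 then [seq e :: v | e <- [:: 1; -1], v <- sign_seqs n']
  else [:: [::]].

(* Coordinates 0-7 form four pairs, exactly one of which is zero in each word.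
   Writing P_j for the product of the j-th pair and r for the product of
   coordinates 8 and 9, the words vanishing on pair i satisfy, for each j <> i,
   an equation +-1 = P_k P_l (times r if i and j are cyclically adjacent),
   {k, l} being the other two pairs. The equations for (i, j) and (j, i) have
   opposite signs, so words vanishing on different pairs differ in sign
   somewhere on their common support; words vanishing on the same pair differ at
   least twice, since each coordinate occurs in one of their equations. *)
Definition words : seq (seq int) :=
  flatten [seq if v is [:: p; q; t; s; r; u] then
    [:: [:: 0; 0; p; s * p; q; - s * r * q; t; s * t; u; r * u; 0];
        [:: p; s * p; 0; 0; q; - s * q; t; - s * r * t; u; r * u; 0];
        [:: p; s * r * p; q; - s * q; 0; 0; t; s * t; u; r * u; 0];
        [:: p; s * p; q; s * r * q; t; s * t; 0; 0; u; r * u; 0]]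
  else [::] | v <- sign_seqs 6].

(** A form of [inner] that [vm_compute] can evaluate. *)
Definition seq_inner (x y : seq int) : int :=
  foldr +%R 0 [seq x`_i * y`_i | i <- iota 0 11].

Lemma words_inner :
  all (fun x => all (fun y => (x == y) || (seq_inner x y <= 4)) words) words.
Proof. by vm_compute. Qed.

(** For ternary words, self-product 8 encodes weight 8. *)
Lemma words_wf :
  all (fun x => [&& size x == 11, all [in [:: 0; 1; -1]] x
                  & seq_inner x x == 8]) words.
Proof. by vm_compute. Qed.

Lemma words_uniq : uniq words. Proof. by vm_compute. Qed.

Lemma size_words : size words = 256. Proof. by vm_compute. Qed.

Definition row_of (x : seq int) : 'rV[int]_11 := \row_i x`_i.

Lemma inner_row_of x y : inner (row_of x) (row_of y) = seq_inner x y.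
Proof.
rewrite /seq_inner foldrE big_map -[iota 0 11]/(index_iota 0 11) big_mkord.
by apply: eq_bigr => i _; rewrite !mxE.
Qed.

Lemma row_of_inj : {in words &, injective row_of}.
Proof.
move=> x y /(allP words_wf)/and3P[/eqP sx _ _].
move=> /(allP words_wf)/and3P[/eqP sy _ _] eq_xy.
apply: (@eq_from_nth _ 0) => [|i lt_i]; first by rewrite sx sy.
rewrite sx in lt_i.
by have /rowP/(_ (Ordinal lt_i)) := eq_xy; rewrite !mxE.
Qed.

Definition best_code : {fset 'rV[int]_11} := [fset x in map row_of words].

Lemma card_best_code : #|` best_code| = 256.
Proof.
rewrite card_fseq undup_id ?size_map ?size_words //.
by rewrite map_inj_in_uniq ?words_uniq //; apply: row_of_inj.
Qed.

Lemma best_codeP : ternary_code 8 4 best_code.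
Proof.
have tern x : x \in words -> ternary (row_of x).
  move=> /(allP words_wf)/and3P[/eqP sx /allP tx _] i.
  by rewrite mxE; apply: tx; rewrite mem_nth ?sx.
have codeP x : x \in best_code -> exists2 x', x' \in words & x = row_of x'.
  by rewrite in_fset => /mapP.
split=> [x|x|x y] /codeP[x' x'W ->].
- exact: tern.
- apply/eqP; rewrite -eqz_nat -inner_ternary ?inner_row_of; last exact: tern.
  by case/(allP words_wf)/and3P: x'W.
move=> /codeP[y' y'W ->] neq_xy.
have /allP/(_ _ y'W)/orP[/eqP eq_xy|] := allP words_inner _ x'W.
  by rewrite eq_xy eqxx in neq_xy.
by rewrite inner_row_of.
Qed.

Theorem proposition6p8 :
  (forall (m w : nat) (s : int) (Q : {fset 'rV[int]_m}),
      ternary_code w s Q ->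
      2 * w%:Z - m%:Z > s ->
      (#|` Q| <= 2 ^ w)%N)
  /\ max_code_size 11 8 4 256.
Proof.
split; first exact: ternary_code_bound.
split; first by exists best_code; [exact: best_codeP | exact: card_best_code].
(* Here [2 * 8 - 11 = 5 > 4] and [2 ^ 8 = 256]. *)
by move=> Q /ternary_code_bound; apply.
Qed.
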